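(* Let $X_1,\ldots,X_n$ be $\{0,1\}$-valued random variables with means $\mathbb{E}[X_i]=x_i$, and suppose that $X_1,\ldots,X_n$ are negatively associated, or that they satisfy negative regression. Let $f:\{0,1\}^n\to\mathbb{R}_{\ge 0}$ be a non-negative, monotone (non-decreasing) submodular function all of whose marginal values $f(S\cup\{i\})-f(S)$ lie in $[0,1]$, and let $F$ be the multilinear extension of $f$. Let $\mu_0=F(x_1,\ldots,x_n)$. Then for every $\delta\in(0,1)$, $$\Pr[f(X_1,\ldots,X_n)\le (1-\delta)\mu_0]\le \exp(-\mu_0\delta^2/2).$$
   Context: Negative association: for all disjoint $I,J\subseteq[n]$ and all non-decreasing $f:\mathbb{R}^I\to\mathbb{R}$, $g:\mathbb{R}^J\to\mathbb{R}$, $\mathbb{E}[f(X_I)g(X_J)]\le\mathbb{E}[f(X_I)]\mathbb{E}[g(X_J)]$, where $X_S=(X_i)_{i\in S}$. Negative regression: for all disjoint $I,J\subseteq[n]$, every non-decreasing $f:\mathbb{R}^I\to\mathbb{R}$ and all $a\le b$ in $\mathbb{R}^J$ (coordinatewise, with $\{X_J=a\}$, $\{X_J=b\}$ of positive probability), $\mathbb{E}[f(X_I)\mid X_J=a]\ge\mathbb{E}[f(X_I)\mid X_J=b]$. Identifying $\{0,1\}^n$ with subsets of $[n]$, $f$ is submodular if $f(S\cup\{i\})-f(S)\ge f(T\cup\{i\})-f(T)$ whenever $S\subseteq T$, $i\notin T$. The multilinear extension is $F(x)=\sum_{S\subseteq[n]}f(S)\prod_{i\in S}x_i\prod_{i\notin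 S}(1-x_i)$ for $x\in[0,1]^n$, i.e. the expectation of $f$ when coordinate $i$ is independently $1$ with probability $x_i$. *)

(* Defs.v *)
From HB Require Import structures.
From mathcomp Require Export all_boot all_order all_algebra.
From mathcomp Require Export all_classical all_reals all_analysis.

Set Implicit Arguments.
Unset Strict Implicit.
Unset Printing Implicit Defensive.

Import Order.TTheory GRing.Theory Num.Theory.
Import numFieldNormedType.Exports.

Local Open Scope classical_set_scope.
Local Open Scope ring_scope.

(* R^I for I a subset of [n]. *)
Definition subvec (R : Type) (n : nat) (I : {set 'I_n}) : Type :=
  {i : 'I_n | i \in I} -> R.

Definition vle (R : realType) (n : nat) (I : {set 'I_n}) (u v : subvec R I) :=
  forall i, u i <= v i.

Definition nondecreasing_on (R : realType) (n : nat) (I : {set 'I_n})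
    (f : subvec R I -> R) :=
  forall u v, vle u v -> f u <= f v.

Definition X_at (d : measure_display) (T : measurableType d) (R : realType)
    (P : probability T R) (n : nat) (X : 'I_n -> {RV P >-> R})
    (I : {set 'I_n}) (w : T) : subvec R I :=
  fun i => X (val i) w.

Arguments X_at {d T R P n} X I w.

(* E[Y | A], meaningful only when P A > 0. *)
Definition cond_exp (d : measure_display) (T : measurableType d) (R : realType)
    (P : probability T R) (Y : T -> R) (A : set T) : \bar R :=
  (((fine (P A))^-1)%:E * \int[P]_(w in A) (Y w)%:E)%E.

(* No measurability or integrability side condition is put on f and g in the
   next two definitions: they are meant for {0,1}-valued X, for which f(X_I)
   and g(X_J) are always simple functions. *)
Definition negatively_associated (d : measure_display) (T : measurableType d)
    (R : realType) (P : probability T R) (n : nat) (X : 'I_n -> {RV P >-> R}) :=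
  forall (I J : {set 'I_n}), [disjoint I & J]%B ->
  forall (f : subvec R I -> R) (g : subvec R J -> R),
    nondecreasing_on f -> nondecreasing_on g ->
    ('E_P[fun w => (f (X_at X I w) * g (X_at X J w))%R] <=
     'E_P[fun w => f (X_at X I w)] * 'E_P[fun w => g (X_at X J w)])%E.

Definition negative_regression (d : measure_display) (T : measurableType d)
    (R : realType) (P : probability T R) (n : nat) (X : 'I_n -> {RV P >-> R}) :=
  forall (I J : {set 'I_n}), [disjoint I & J]%B ->
  forall (f : subvec R I -> R), nondecreasing_on f ->
  forall (a b : subvec R J), vle a b ->
    (0 < P [set w | X_at X J w = a])%E ->
    (0 < P [set w | X_at X J w = b])%E ->
    (cond_exp P (fun w => f (X_at X I w)) [set w | X_at X J w = b] <=
     cond_exp P (fun w => f (X_at X I w)) [set w | X_at X J w = a])%E.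

(* Functions on {0,1}^n are functions on {set 'I_n}. *)
Definition monotone_setfun (R : realType) (n : nat) (f : {set 'I_n} -> R) :=
  forall S U : {set 'I_n}, S \subset U -> f S <= f U.

Definition submodular (R : realType) (n : nat) (f : {set 'I_n} -> R) :=
  forall (S U : {set 'I_n}) (i : 'I_n), S \subset U -> i \notin U ->
    f (i |: U)%SET - f U <= f (i |: S)%SET - f S.

Definition multilinear_ext (R : realType) (n : nat) (f : {set 'I_n} -> R)
    (x : 'I_n -> R) : R :=
  \sum_(S : {set 'I_n})
    f S * (\prod_(i in S) x i) * (\prod_(i | i \notin S) (1 - x i)).

(* The point (X_1(w), ..., X_n(w)) of {0,1}^n, as a subset of [n]. *)
Definition outcome (d : measure_display) (T : measurableType d) (R : realType)
    (P : probability T R) (n : nat) (X : 'I_n -> {RV P >-> R}) (w : T) :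
    {set 'I_n} :=
  [set i | X i w == 1]%SET.

(* Main.v *)
Require Import Defs.
From mathcomp Require Import ring lra.
Set Implicit Arguments.
Unset Strict Implicit.
Unset Printing Implicit Defensive.
Import Order.TTheory GRing.Theory Num.Theory.
Import numFieldNormedType.Exports.
Local Open Scope classical_set_scope.
Local Open Scope ring_scope.

(** Let [g S = expR (- (delta * f S))].  Since [f] is monotone and submodular, [- g] is
    submodular.  Negative association and negative regression both imply that [X i] is
    negatively correlated with every monotone function of the other coordinates, so
    replacing the coordinates one at a time by independent copies can only increase
    the expectation of [g].  For independent coordinates, Harris' inequality decouples
    the successive increments of [f] and gives the bound
    [expR (- ((1 - expR (- delta)) * mu0))].  Markov's inequality for [g], together with
    [expR (- delta) <= 1 - delta + delta ^+ 2 / 2], concludes; the exponent [delta]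
    is not the optimal [- ln (1 - delta)], but it is enough. *)

(* Resamples coordinate [i] as an independent Bernoulli variable of mean [x i]. *)
Definition mix (R : realType) (n : nat) (x : 'I_n -> R) (i : 'I_n)
    (h : {set 'I_n} -> R) (S : {set 'I_n}) : R :=
  (1 - x i) * h (S :\ i)%SET + x i * h (i |: S)%SET.

Definition antitone_setfun (R : realType) (n : nat) (h : {set 'I_n} -> R) :=
  forall S U : {set 'I_n}, S \subset U -> h U <= h S.

Definition ignores (R : realType) (n : nat) (i : 'I_n) (h : {set 'I_n} -> R) :=
  forall S : {set 'I_n}, h (i |: S)%SET = h S.

(** * Resampling single coordinates and the multilinear extension *)

Lemma setU1_setD1 (n : nat) (i j : 'I_n) (S : {set 'I_n}) : i != j ->
  ((j |: S) :\ i = j |: (S :\ i))%SET.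
Proof.
move=> ij; apply/setP=> k; rewrite !inE.
by case: (eqVneq k i) => //= ->; rewrite (negPf ij).
Qed.

Lemma setD1_setU1 (n : nat) (i : 'I_n) (S : {set 'I_n}) :
  ((i |: S) :\ i = S :\ i)%SET.
Proof. by apply/setP=> k; rewrite !inE; case: (eqVneq k i). Qed.

Lemma setU1_setD1_id (n : nat) (i : 'I_n) (S : {set 'I_n}) :
  (i |: (S :\ i) = i |: S)%SET.
Proof. by apply/setP=> k; rewrite !inE; case: (eqVneq k i). Qed.

Lemma setD1_notin (n : nat) (i : 'I_n) (S : {set 'I_n}) :
  i \notin S -> (S :\ i = S)%SET.
Proof.
move=> iS; apply/setP => k; rewrite !inE.
by case: eqVneq => //= ->; rewrite (negPf iS).
Qed.

Lemma setU1_in (n : nat) (i : 'I_n) (S : {set 'I_n}) :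
  i \in S -> (i |: S = S)%SET.
Proof.
move=> iS; apply/setP => k; rewrite !inE.
by case: eqVneq => //= ->; rewrite iS.
Qed.

Lemma sum_setU1 (R : realType) (n : nat) (i : 'I_n) (h : {set 'I_n} -> R) :
  \sum_(S : {set 'I_n}) h S =
  \sum_(S : {set 'I_n} | i \notin S) (h S + h (i |: S)%SET).
Proof.
rewrite big_split/= (bigID (fun S : {set 'I_n} => i \in S))/= addrC; congr +%R.
rewrite (reindex_onto (fun S => i |: S)%SET (fun S => S :\ i)%SET); last first.
  by move=> S iS; rewrite setU1_setD1_id setU1_in.
apply: eq_bigl => S; rewrite !inE eqxx/= setD1_setU1.
apply/eqP/idP => [<-|/setD1_notin//]; by rewrite !inE eqxx.
Qed.

(** Resampling [i] erases the dependence on [i], and for [i != j] it commutes with adding [j], so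
    independence of [j] survives. *)
Lemma ignores_mix (R : realType) (n : nat) (x : 'I_n -> R) (i j : 'I_n) h :
  i = j \/ ignores j h -> ignores j (mix x i h).
Proof.
have [<- _ S|ij/= hj S] := eqVneq i j; rewrite /mix.
  by rewrite setD1_setU1 (@setU1_in _ i (i |: S)%SET)// !inE eqxx.
case: hj => [ij'|hj]; first by rewrite ij' eqxx in ij.
by rewrite setU1_setD1// finset.setUCA !hj.
Qed.

Lemma ignores_foldr_mix (R : realType) (n : nat) (x : 'I_n -> R) r h j :
  j \in r -> ignores j (foldr (mix x) h r).
Proof.
elim: r => //= i r ih; rewrite inE => /orP[/eqP->|/ih jr].
  by apply: ignores_mix; left.
by apply: ignores_mix; right.
Qed.

Lemma ignores_all_cst (R : realType) (n : nat) (h : {set 'I_n} -> R) :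
  (forall i, ignores i h) -> forall S, h S = h finset.set0.
Proof.
move=> hi S; elim: {S}#|S| {-2}S (erefl #|S|) => [S /cards0_eq ->//|m ih S Sm].
have /card_gt0P[i iS] : (0 < #|S|)%N by rewrite Sm.
have := cardsD1 i S; rewrite Sm iS add1n => -[Sm'].
by rewrite -(ih (S :\ i)%SET)// -(hi i (S :\ i)%SET) setU1_setD1_id setU1_in.
Qed.

(** Pair [S] with [i |: S]: their weights are [1 - x i] and [x i] times a common factor. The
    resampled function takes on both sets the weighted mean of the two values of [h]. *)
Lemma multilinear_ext_mix (R : realType) (n : nat) (x : 'I_n -> R) i h :
  multilinear_ext (mix x i h) x = multilinear_ext h x.
Proof.
rewrite /multilinear_ext !(sum_setU1 i); apply: eq_bigr => S iS.
rewrite big_setU1//=.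
have -> : \prod_(j | j \notin S) (1 - x j) =
    (1 - x i) * \prod_(j | j \notin (i |: S)%SET) (1 - x j).
  rewrite (bigD1 i)//=; congr *%R; apply: eq_bigl => j.
  by rewrite !inE negb_or andbC.
rewrite ignores_mix; last by left.
rewrite /mix setD1_notin//; ring.
Qed.

(** The weights are the terms in the expansion of the product of the factors [x i + (1 - x i)],
    hence sum to 1. *)
Lemma multilinear_ext_cst (R : realType) (n : nat) (x : 'I_n -> R) (c : R) :
  multilinear_ext (fun=> c) x = c.
Proof.
rewrite /multilinear_ext.
under eq_bigr do rewrite -mulrA.
rewrite -mulr_sumr -[RHS]mulr1; congr *%R.
transitivity (\prod_(i < n) (x i + (1 - x i))); last first.
  by rewrite big1// => i _; ring.
rewrite bigA_distr; apply: eq_bigr => S _.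
rewrite [RHS](bigID (fun i => i \in S))/=; congr *%R; apply: eq_bigr => i.
  by move=> ->.
by move=> /negPf ->.
Qed.

(** Once every coordinate is resampled the function is constant, and no resampling has changed its
    multilinear extension. Statements about the latter can thus be proved by induction on the list
    of resampled coordinates. *)
Lemma foldr_mixE (R : realType) (n : nat) (x : 'I_n -> R) h S :
  foldr (mix x) h (enum 'I_n) S = multilinear_ext h x.
Proof.
transitivity (multilinear_ext (foldr (mix x) h (enum 'I_n)) x); last first.
  by elim: (enum _) => //= i r <-; rewrite multilinear_ext_mix.
have E := @ignores_all_cst R n (foldr (mix x) h (enum 'I_n))
  (fun i => @ignores_foldr_mix R n x _ h i (mem_enum _ i)).
rewrite E -[LHS](multilinear_ext_cst x).
by apply: eq_bigr => U _; rewrite E.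
Qed.

Lemma le_multilinear_ext (R : realType) (n : nat) (x : 'I_n -> R) g h :
  (forall i, 0 <= x i <= 1) -> (forall S, g S <= h S) ->
  multilinear_ext g x <= multilinear_ext h x.
Proof.
move=> x01 gh; apply: ler_sum => S _; rewrite -!mulrA ler_wpM2r// mulr_ge0//.
  by apply: prodr_ge0 => i _; case/andP: (x01 i).
by apply: prodr_ge0 => i _; rewrite subr_ge0; case/andP: (x01 i).
Qed.

Lemma multilinear_ext_affine (R : realType) (n : nat) (x : 'I_n -> R) g h a :
  multilinear_ext (fun S => g S + a * h S) x =
  multilinear_ext g x + a * multilinear_ext h x.
Proof.
rewrite /multilinear_ext mulr_sumr -big_split/=; apply: eq_bigr => S _; ring.
Qed.

(** * Order properties under resampling, Harris' inequality and dominance *)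

Lemma antitone_mix (R : realType) (n : nat) (x : 'I_n -> R) i h :
  0 <= x i <= 1 -> antitone_setfun h -> antitone_setfun (mix x i h).
Proof.
move=> /andP[x0 x1] hh S U SU; apply: lerD; apply: ler_wpM2l; rewrite ?subr_ge0//.
  by apply: hh; exact: finset.setSD.
by apply: hh; exact: finset.setUS.
Qed.

Lemma monotone_mix (R : realType) (n : nat) (x : 'I_n -> R) i h :
  0 <= x i <= 1 -> monotone_setfun h -> monotone_setfun (mix x i h).
Proof.
move=> /andP[x0 x1] hh S U SU; apply: lerD; apply: ler_wpM2l; rewrite ?subr_ge0//.
  by apply: hh; exact: finset.setSD.
by apply: hh; exact: finset.setUS.
Qed.

(** An increment along [j != i] becomes a convex combination of two increments of [h], one without
    [i] and one with it; along [i] itself the increment vanishes. *)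
Lemma submodular_mix (R : realType) (n : nat) (x : 'I_n -> R) i h :
  0 <= x i <= 1 -> submodular h -> submodular (mix x i h).
Proof.
move=> /andP[x0 x1] hh S U j SU jU.
have [<-|ij] := eqVneq i j; first by rewrite !ignores_mix ?subrr//; left.
rewrite /mix !setU1_setD1// !(finset.setUCA [set i]%SET).
have := hh (S :\ i)%SET (U :\ i)%SET j (finset.setSD _ SU).
have := hh (i |: S)%SET (i |: U)%SET j (finset.setUS _ SU).
rewrite !inE (negPf jU) eq_sym (negPf ij)/= => /(_ isT) H1 /(_ isT) H0.
have : 0 <= 1 - x i by rewrite subr_ge0.
nra.
Qed.

(* Harris' inequality *)
Lemma multilinear_ext_mul_le (R : realType) (n : nat) (x : 'I_n -> R) u v :
  (forall i, 0 <= x i <= 1) -> antitone_setfun u -> monotone_setfun v ->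
  multilinear_ext (fun S => u S * v S) x <=
  multilinear_ext u x * multilinear_ext v x.
Proof.
move=> x01 hu hv.
rewrite -!(foldr_mixE _ _ finset.set0).
have H r : [/\ antitone_setfun (foldr (mix x) u r),
    monotone_setfun (foldr (mix x) v r) &
    forall S, foldr (mix x) (fun S => u S * v S) r S <=
      foldr (mix x) u r S * foldr (mix x) v r S].
  elim: r => [|i r [ihu ihv ih]]; first by split.
  split=> [||S] /=; [exact: antitone_mix|exact: monotone_mix|].
  have /andP[x0 x1] := x01 i.
  set uv := foldr _ (fun S => _) r in ih *.
  have x1' : 0 <= 1 - x i by rewrite subr_ge0.
  have sub : (S :\ i \subset i |: S)%SET.
    by apply: (fintype.subset_trans (subD1set _ _) (finset.subsetUr _ _)).
  apply: (le_trans (lerD (ler_wpM2l x1' (ih _)) (ler_wpM2l x0 (ih _)))).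
  rewrite /mix.
  (* With subscripts 0 and 1 for the values at [S :\ i] and [i |: S], the gap to be shown
     nonnegative is exactly [x i * (1 - x i) * (u0 - u1) * (v1 - v0)]. *)
  have /ihu := sub; have /ihv := sub.
  rewrite -(subr_ge0 (foldr _ v _ _)) -(subr_ge0 (foldr _ u _ _)) => Hv Hu.
  have := mulr_ge0 (mulr_ge0 x0 x1') (mulr_ge0 Hu Hv).
  rewrite -subr_ge0 => H; rewrite -subr_ge0; apply: (le_trans H).
  by rewrite le_eqVlt; apply/orP; left; apply/eqP; ring.
by have [_ _ ->] := H (enum 'I_n).
Qed.

(** Each resampling can only lower the mean under [p]; after the last one the function is the
    constant [multilinear_ext h x]. *)
Lemma submodular_dominance (R : realType) (n : nat) (x : 'I_n -> R)
    (p : {set 'I_n} -> R) h :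
  (forall i, 0 <= x i <= 1) -> \sum_S p S = 1 ->
  (forall i g, monotone_setfun g -> ignores i g ->
    \sum_S p S * ((i \in S)%:R * g S) <= x i * \sum_S p S * g S) ->
  submodular h ->
  multilinear_ext h x <= \sum_S p S * h S.
Proof.
move=> x01 p1 pN hh.
have H r : submodular (foldr (mix x) h r) /\
    \sum_S p S * foldr (mix x) h r S <= \sum_S p S * h S.
  elim: r => [//|i r [ihs ih]] /=; split; first exact: submodular_mix.
  apply: le_trans ih; set k := foldr _ _ _ in ihs *.
  (* The test function [g] is minus the increment of [k] along [i], monotone by submodularity.
     Pointwise, [k S - mix x i k S] equals [(x i - (i \in S)%:R) * g S]. *)
  have := pN i (fun S => k (S :\ i)%SET - k (i |: S)%SET) _ _.
  rewrite mulr_sumr -subr_ge0 -sumrB => H.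
  rewrite -subr_ge0 -sumrB; apply: (le_trans (H _ _)) => {H}.
  - move=> S U SU.
    have := ihs (S :\ i)%SET (U :\ i)%SET i (finset.setSD _ SU).
    by rewrite !inE eqxx !setU1_setD1_id => /(_ isT); lra.
  - by move=> S; rewrite setD1_setU1 (@setU1_in _ i (i |: S)%SET)// !inE eqxx.
  rewrite le_eqVlt; apply/orP; left; apply/eqP; apply: eq_bigr => S _.
  rewrite /mix; have [iS|iS] := boolP (i \in S).
    by rewrite setU1_in//=; ring.
  by rewrite setD1_notin//=; ring.
have [_] := H (enum 'I_n).
under eq_bigr do rewrite foldr_mixE.
by rewrite -mulr_suml p1 mul1r.
Qed.

(** * Exponential estimates and the independent case *)

Lemma expRN_le_chord (R : realType) (l m : R) : 0 <= m <= 1 ->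
  expR (- (l * m)) <= 1 - (1 - expR (- l)) * m.
Proof.
move=> /andP[m0 m1].
have := convex_expR (Itv01 m0 m1) (- l) 0.
rewrite !convRE/= expR0 mulr0 addr0 mulr1 mulrN mulrC.
by rewrite (_ : 1 - _ = m * expR (- l) + (1 - m)); last ring.
Qed.

(** Truncating the exponential series bounds [expR t] below by [1 + t + t ^+ 2 / 2], and the product
    of this with the claimed bound is [1 + t ^+ 4 / 4], at least 1. *)
Lemma expRN_le_quad (R : realType) (t : R) : 0 <= t ->
  expR (- t) <= 1 - t + t ^+ 2 / 2.
Proof.
move=> t0; have E : 1 + t + t ^+ 2 / 2 <= expR t.
  have -> : 1 + t + t ^+ 2 / 2 = series (exp_coeff t) 3.
    by rewrite /series/= !big_nat_recr//= big_geq// /exp_coeff/= /factorial/=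
      add0r expr0 expr1 !divr1.
  apply: nondecreasing_cvgn_le; last exact: is_cvg_series_exp_coeff.
  by apply/nondecreasing_seqP => k; rewrite seriesSr lerDl exp_coeff_ge0.
rewrite expRN -[leLHS]mul1r ler_pdivrMr ?expR_gt0//.
have q : 0 <= 1 - t + t ^+ 2 / 2 by nra.
apply: (le_trans _ (ler_wpM2l q E)).
have -> : (1 - t + t ^+ 2 / 2) * (1 + t + t ^+ 2 / 2) = 1 + (t ^+ 2 / 2) ^+ 2.
  by field.
by rewrite lerDl sqr_ge0.
Qed.

(** The increment at [S] factors as [expR (- (l * f S))] times
    [1 - expR (- (l * (f (i |: S) - f S)))]; both factors are nonnegative and decrease as [S]
    grows. *)
Lemma submodular_NexpRN (R : realType) (n : nat) (f : {set 'I_n} -> R) (l : R) :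
  0 <= l -> monotone_setfun f -> submodular f ->
  submodular (fun S => - expR (- (l * f S))).
Proof.
move=> l0 fm fs S U i SU iU.
have e T : expR (- (l * f (i |: T)%SET)) =
    expR (- (l * f T)) * expR (- (l * (f (i |: T)%SET - f T))).
  by rewrite -expRD; congr expR; ring.
rewrite !e.
have ab : expR (- (l * f U)) <= expR (- (l * f S)).
  by rewrite ler_expR lerN2 ler_wpM2l// fm.
have uv : expR (- (l * (f (i |: S)%SET - f S))) <=
    expR (- (l * (f (i |: U)%SET - f U))).
  by rewrite ler_expR lerN2 ler_wpM2l// fs.
have u1 : expR (- (l * (f (i |: U)%SET - f U))) <= 1.
  by rewrite expR_le1 oppr_le0 mulr_ge0// subr_ge0 fm// finset.subsetUr.
have := expR_ge0 (- (l * f S)).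
move: ab uv u1; move: (expR _) (expR _) (expR _) (expR _) => a b c d0.
rewrite -subr_ge0 => ab; rewrite -subr_ge0 => dc; rewrite -subr_ge0 => c1 b0.
have := mulr_ge0 ab c1; have := mulr_ge0 b0 dc; lra.
Qed.

(* Coordinates are revealed one at a time: given the earlier ones, the increment
   of f is antitone in them, so Harris' inequality decouples it. *)
Lemma multilinear_ext_expRN_le (R : realType) (n : nat) (x : 'I_n -> R)
    (f : {set 'I_n} -> R) (l : R) :
  (forall i, 0 <= x i <= 1) -> 0 <= l -> (forall S, 0 <= f S) ->
  monotone_setfun f -> submodular f ->
  (forall (S : {set 'I_n}) i, f (i |: S)%SET - f S <= 1) ->
  multilinear_ext (fun S => expR (- (l * f S))) x <=
  expR (- ((1 - expR (- l)) * multilinear_ext f x)).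
Proof.
move=> x01 l0 f0 fm fs f1.
set c := 1 - expR (- l).
have c0 : 0 <= c by rewrite subr_ge0 expR_le1 oppr_le0.
have cl : c <= l by have := expR_ge1Dx (- l); rewrite /c; lra.
pose fr (A : {set 'I_n}) (S : {set 'I_n}) := f (S :&: A)%SET.
suff H r : uniq r -> multilinear_ext (fun S => expR (- (l * fr [set j in r]%SET S))) x <=
    expR (- (c * multilinear_ext (fr [set j in r]%SET) x)).
  have := H (enum 'I_n) (enum_uniq _).
  have -> : fr [set j in enum 'I_n]%SET = f.
    apply/funext => S; rewrite /fr; congr f.
    by apply/setP => j; rewrite !inE mem_enum andbT.
  by [].
elim: r => [_|i r ih /= /andP[ir /ih {}ih]].
  (* With nothing revealed, [f] contributes only the value at the empty set, which may be positive;
     this case rests on [c <= l]. *)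
  have -> : fr [set j in [::]]%SET = fun=> f finset.set0.
    by apply/funext => S; rewrite /fr; congr f; apply/setP => j; rewrite !inE andbF.
  by rewrite !multilinear_ext_cst ler_expR lerN2 ler_wpM2r.
rewrite set_cons; set A := [set j in r]%SET in ih *.
have iA : i \notin A by rewrite inE.
(* The increment of [f] caused by [i] on top of the revealed coordinates [A]. *)
pose m S := f (i |: (S :&: A))%SET - fr A S.
have mix_fr (phi : R -> R) S : mix x i (fun S => phi (fr (i |: A)%SET S)) S =
    (1 - x i) * phi (fr A S) + x i * phi (fr A S + m S).
  rewrite /mix /m /fr addrCA subrr addr0.
  congr (_ * phi (f _) + _ * phi (f _)); apply/setP => j; rewrite !inE.
    by case: eqVneq => //= ->; rewrite (negPf ir) andbF.
  by case: eqVneq.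
have ma : antitone_setfun m.
  move=> S U SU; have [iU|iU] := boolP (i \in (U :&: A)%SET).
    by move: iU; rewrite !inE (negPf ir) andbF.
  by apply: fs => //; exact: finset.setSI.
have m01 S : 0 <= m S <= 1 by rewrite f1 subr_ge0 fm// finset.subsetUr.
have -> : multilinear_ext (fr (i |: A)%SET) x =
    multilinear_ext (fr A) x + x i * multilinear_ext m x.
  rewrite -(multilinear_ext_mix _ i) -multilinear_ext_affine; apply: eq_bigr => S _.
  by rewrite (mix_fr id)/=; congr (_ * _ * _); ring.
(* Averaging over coordinate [i] leaves the factor [u] of the earlier coordinates times a factor
   that the chord bound puts below [v]. As [m] is antitone, [v] is monotone, as Harris' inequality
   demands. *)
pose u S := expR (- (l * fr A S)).
pose v S := 1 + (- (c * x i)) * m S.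
have /andP[xi0 xi1] := x01 i.
have ua : antitone_setfun u.
  by move=> S U SU; rewrite ler_expR lerN2 ler_wpM2l// fm// finset.setSI.
have vm : monotone_setfun v.
  by move=> S U /ma SU; rewrite lerD2l !mulNr lerN2 ler_wpM2l// mulr_ge0.
apply: (@le_trans _ _ (multilinear_ext (fun S => u S * v S) x)).
  rewrite -(multilinear_ext_mix _ i); apply: le_multilinear_ext => // S.
  rewrite (mix_fr (fun z => expR (- (l * z)))) mulrDr opprD expRD -/(u S).
  have u0 : 0 <= u S by exact: expR_ge0.
  have := ler_wpM2l (mulr_ge0 xi0 u0) (expRN_le_chord l (m01 S)).
  rewrite -/c /v; lra.
apply: (le_trans (multilinear_ext_mul_le x01 ua vm)).
rewrite (multilinear_ext_affine x (fun=> 1) m) multilinear_ext_cst.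
have u0 : 0 <= multilinear_ext u x.
  rewrite -(multilinear_ext_cst x 0); apply: le_multilinear_ext => // S.
  exact: expR_ge0.
rewrite [X in _ <= expR (- X)]mulrDr opprD expRD; apply: ler_pM => //.
- have : multilinear_ext m x <= 1.
    rewrite -(multilinear_ext_cst x 1); apply: le_multilinear_ext => // S.
    by case/andP: (m01 S).
  have : 0 <= multilinear_ext m x.
    rewrite -(multilinear_ext_cst x 0); apply: le_multilinear_ext => // S.
    by case/andP: (m01 S).
  have c1 : c <= 1 by rewrite /c gerBl expR_ge0.
  move=> M0 M1; have := mulr_ile1 (mulr_ge0 c0 xi0) M0 (mulr_ile1 c0 xi0 c1 xi1) M1.
  by rewrite mulNr subr_ge0.
- by rewrite mulNr mulrA; exact: expR_ge1Dx.
Qed.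

(** * The law of the outcome: integrals as finite sums *)

Lemma measurable_outcome (d : measure_display) (T : measurableType d)
    (R : realType) (P : probability T R) (n : nat) (X : 'I_n -> {RV P >-> R})
    (B : set {set 'I_n}) :
  measurable (outcome X @^-1` B).
Proof.
have m1 i : measurable (X i @^-1` [set 1]).
  by rewrite -[_ @^-1` _]setTI; exact: measurable_funP.
have mS S : measurable (outcome X @^-1` [set S]).
  have -> : outcome X @^-1` [set S] = \bigcap_(i in [set: 'I_n])
      (if i \in S then X i @^-1` [set 1] else ~` (X i @^-1` [set 1])).
    apply/seteqP; split => w /= => [<- i _|H].
      by rewrite inE; case: eqP.
    apply/setP => i; rewrite inE; have := H i I.
    by case: ifPn => _ /= => [->|/eqP/negPf //]; rewrite eqxx.
  apply: fin_bigcap_measurable; first exact: finite_finset.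
  by move=> i _; case: ifPn => _ //; exact: measurableC.
have -> : outcome X @^-1` B = \bigcup_(S in B) outcome X @^-1` [set S].
  by apply/seteqP; split => [w Bw|w [S BS /= ->//]]; exists (outcome X w).
by apply: fin_bigcup_measurable; first exact: finite_finset.
Qed.

Definition outcome_law (d : measure_display) (T : measurableType d)
    (R : realType) (P : probability T R) (n : nat) (X : 'I_n -> {RV P >-> R})
    (S : {set 'I_n}) : R :=
  fine (P (outcome X @^-1` [set S])).

(** The outcome has finitely many values, so the integrand is a finite combination of indicators of
    its fibres. *)
Lemma integral_outcome (d : measure_display) (T : measurableType d)
    (R : realType) (P : probability T R) (n : nat) (X : 'I_n -> {RV P >-> R})
    (h : {set 'I_n} -> R) :
  (\int[P]_w (h (outcome X w))%:E)%E = (\sum_S outcome_law X S * h S)%:E.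
Proof.
have mO := measurable_outcome X.
have E w : (h (outcome X w))%:E = (\sum_(S : {set 'I_n})
    ((h S)%:E * (\1_(outcome X @^-1` [set S]) w)%:E))%E.
  rewrite (bigD1 (outcome X w))//= big1 ?adde0; last first.
    move=> S SX; rewrite indicE memNset ?mule0//= => OS.
    by rewrite OS eqxx in SX.
  by rewrite indicE mem_set//= mule1.
under eq_integral do rewrite E.
rewrite integral_sum//; last first.
  by move=> S; apply: integrableZl => //; exact: integrable_indic.
rewrite -sumEFin; apply: eq_bigr => S _.
rewrite integralZl//; last exact: integrable_indic.
by rewrite integral_indic// setIT EFinM muleC fineK// fin_num_measure.
Qed.

Lemma outcome_law_ge0 (d : measure_display) (T : measurableType d)
    (R : realType) (P : probability T R) (n : nat) (X : 'I_n -> {RV P >-> R}) S :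
  0 <= outcome_law X S.
Proof. exact: fine_ge0. Qed.

Lemma sum_outcome_law (d : measure_display) (T : measurableType d)
    (R : realType) (P : probability T R) (n : nat) (X : 'I_n -> {RV P >-> R}) :
  \sum_S outcome_law X S = 1.
Proof.
have := integral_outcome X (fun=> 1).
rewrite integral_cst//= probability_setT mule1 => -[].
by under eq_bigr do rewrite mulr1; move=> <-.
Qed.

Lemma expectation_outcome (d : measure_display) (T : measurableType d)
    (R : realType) (P : probability T R) (n : nat) (X : 'I_n -> {RV P >-> R})
    (h : {set 'I_n} -> R) :
  'E_P[fun w => h (outcome X w)]%E = (\sum_S outcome_law X S * h S)%:E.
Proof. by rewrite unlock integral_outcome. Qed.

Lemma probability_outcome (d : measure_display) (T : measurableType d)
    (R : realType) (P : probability T R) (n : nat) (X : 'I_n -> {RV P >-> R})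
    (B : pred {set 'I_n}) :
  P [set w | B (outcome X w)] = (\sum_S outcome_law X S * (B S)%:R)%:E.
Proof.
rewrite -(integral_outcome X (fun S => (B S)%:R)).
rewrite -[LHS]expectation_indic; last exact: (measurable_outcome X [set S | B S]).
rewrite unlock; apply: eq_integral => w _; rewrite indicE.
have [Bw|/negP Bw] := boolP (B (outcome X w)); first by rewrite mem_set.
by rewrite memNset.
Qed.

Lemma integral_outcome_in (d : measure_display) (T : measurableType d)
    (R : realType) (P : probability T R) (n : nat) (X : 'I_n -> {RV P >-> R})
    (B : pred {set 'I_n}) (h : {set 'I_n} -> R) :
  (\int[P]_(w in [set w | B (outcome X w)]) (h (outcome X w))%:E)%E =
  (\sum_S outcome_law X S * ((B S)%:R * h S))%:E.
Proof.
rewrite integral_mkcond -integral_outcome; apply: eq_integral => w _.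
rewrite patchE; have [Bw|Bw] := boolP (B (outcome X w)).
  by rewrite mem_set//= mul1r.
by rewrite memNset ?mul0r//=; exact/negP.
Qed.

(** * From negative dependence to negative covariance *)

Lemma RV01E (d : measure_display) (T : measurableType d)
    (R : realType) (P : probability T R) (n : nat) (X : 'I_n -> {RV P >-> R}) :
  (forall i w, X i w = 0 \/ X i w = 1) ->
  forall i w, X i w = (i \in outcome X w)%:R.
Proof.
by move=> X01 i w; rewrite inE; case: (X01 i w) => ->; rewrite ?eqxx// eq_sym oner_eq0.
Qed.

(** Carries set functions over to real vectors: thresholding at 0 is monotone on all of [subvec R I]
    and recovers the support of a 0/1 vector. Indices outside [I] count as absent. *)
Definition pos_coords (R : realType) (n : nat) (I : {set 'I_n})
    (u : subvec R I) : {set 'I_n} :=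
  [set j | if insub j is Some k then 0 < u k else false]%SET.

Lemma pos_coords_le (R : realType) (n : nat) (I : {set 'I_n})
    (u v : subvec R I) : vle u v -> pos_coords u \subset pos_coords v.
Proof.
move=> uv; apply/fintype.subsetP => j; rewrite !inE.
by case: insub => // k /lt_le_trans; apply.
Qed.

Lemma pos_coords_X_at (d : measure_display) (T : measurableType d)
    (R : realType) (P : probability T R) (n : nat) (X : 'I_n -> {RV P >-> R})
    (X01 : forall i w, X i w = 0 \/ X i w = 1) (I : {set 'I_n}) (w : T) :
  pos_coords (X_at X I w) = (outcome X w :&: I)%SET.
Proof.
apply/setP => j; rewrite [LHS]inE [RHS]inE.
case: insubP => [k jI kj|/negPf ->]; last by rewrite andbF.
rewrite /X_at kj jI andbT (RV01E X01).
by case: (j \in outcome X w); rewrite ?ltr01 ?ltxx.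
Qed.

(** Both hypotheses are applied to [J] the singleton of [i] and [I] its complement. Association
    gives the covariance bound directly; regression compares the means of [g] given [X i = 0] and
    given [X i = 1]. *)
Lemma negative_covariance (d : measure_display) (T : measurableType d)
    (R : realType) (P : probability T R) (n : nat) (X : 'I_n -> {RV P >-> R})
    (X01 : forall i w, X i w = 0 \/ X i w = 1)
    (XN : negatively_associated X \/ negative_regression X)
    (i : 'I_n) (g : {set 'I_n} -> R) :
  monotone_setfun g -> ignores i g ->
  \sum_S outcome_law X S * ((i \in S)%:R * g S) <=
  (\sum_S outcome_law X S * (i \in S)%:R) * \sum_S outcome_law X S * g S.
Proof.
move=> gm gi.
pose I := (~: [set i])%SET; pose J := [set i]%SET.
have IJ : [disjoint I & J]%B by rewrite finset.disjoints_subset.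
have iJ : i \in J by rewrite inE.
pose G (u : subvec R I) := g (pos_coords u).
have Gm : nondecreasing_on G by move=> u v uv; exact/gm/pos_coords_le.
have GE w : G (X_at X I w) = g (outcome X w).
  (* Intersecting with [I] only drops [i]; adding [i] on both sides makes the two sets equal. *)
  rewrite /G pos_coords_X_at// -gi -[RHS]gi; congr g.
  by apply/setP => j; rewrite !inE; case: eqVneq; rewrite ?andbT.
case: XN => [NA|NR].
  pose K (u : subvec R J) := u (exist _ i iJ).
  have Km : nondecreasing_on K by move=> u v; exact.
  have := NA I J IJ G K Gm Km.
  have -> : (fun w => G (X_at X I w) * K (X_at X J w)) =
      (fun w => (fun S : {set 'I_n} => (i \in S)%:R * g S) (outcome X w)).
    by apply/funext => w; rewrite GE /K /X_at/= (RV01E X01) mulrC.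
  have -> : (fun w => K (X_at X J w)) =
      (fun w => (fun S : {set 'I_n} => (i \in S)%:R) (outcome X w)).
    by apply/funext => w; rewrite /K /X_at/= (RV01E X01).
  rewrite (_ : (fun w => G (X_at X I w)) = (fun w => g (outcome X w))); last first.
    exact/funext.
  rewrite (expectation_outcome X (fun S => (i \in S)%:R * g S)).
  rewrite (expectation_outcome X (fun S => (i \in S)%:R)) (expectation_outcome X g).
  by rewrite -EFinM lee_fin mulrC.
have X_J (b : bool) : [set w | X_at X J w = fun=> b%:R] =
    [set w | (fun S : {set 'I_n} => (i \in S) == b) (outcome X w)].
  apply/seteqP; split => w /=.
    move=> /(congr1 (fun u : subvec R J => u (exist _ i iJ))).
    rewrite /X_at/= (RV01E X01); case: b (i \in _) => [] [] //= /eqP;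
    by rewrite ?oner_eq0// eq_sym oner_eq0.
  move=> /eqP ib; apply/funext => -[j jJ]; rewrite /X_at/=.
  by move: (jJ); rewrite inE => /eqP ->; rewrite (RV01E X01) ib.
have p1 := sum_outcome_law X; have p0 := outcome_law_ge0 X.
(* [x b] is the probability that the membership of [i] equals [b], and [y b] is the integral of [g]
   over that event. *)
pose x b := \sum_S outcome_law X S * ((i \in S) == b)%:R.
pose y b := \sum_S outcome_law X S * (((i \in S) == b)%:R * g S).
have x0 b : 0 <= x b by apply: sumr_ge0 => S _; rewrite mulr_ge0.
have xx : x false + x true = 1.
  rewrite -p1 -big_split/=; apply: eq_bigr => S _.
  by case: (i \in S) => /=; rewrite ?mulr1 ?mulr0 ?addr0 ?add0r.
have yy : \sum_S outcome_law X S * g S = y false + y true.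
  rewrite -big_split/=; apply: eq_bigr => S _.
  by case: (i \in S) => /=; rewrite ?mul1r ?mul0r ?mulr0 ?addr0 ?add0r.
have y_eq0 b : x b = 0 -> y b = 0.
  move=> /eqP; rewrite psumr_eq0 => [/allP H|S _]; last by rewrite mulr_ge0.
  apply: big1 => S _; have := H S (mem_index_enum _) => /eqP.
  by rewrite mulrA => ->; rewrite mul0r.
rewrite yy.
have -> : \sum_S outcome_law X S * ((i \in S)%:R * g S) = y true.
  by apply: eq_bigr => S _; rewrite eqb_id.
have -> : \sum_S outcome_law X S * (i \in S)%:R = x true.
  by apply: eq_bigr => S _; rewrite eqb_id.
(* Regression needs both conditioning events to have positive probability. If either is null, the
   inequality is an equality. *)
have [xt0|xt] := eqVneq (x true) 0; first by rewrite xt0 mul0r y_eq0.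
have [xf0|xf] := eqVneq (x false) 0.
  by move: xx; rewrite xf0 add0r => ->; rewrite (y_eq0 false xf0) add0r mul1r.
have {}xt : 0 < x true by rewrite lt_def xt x0.
have {}xf : 0 < x false by rewrite lt_def xf x0.
have PX (b : bool) : P [set w | X_at X J w = fun=> b%:R] = (x b)%:E.
  by rewrite X_J (probability_outcome X (fun S => (i \in S) == b)).
have IX (b : bool) : (\int[P]_(w in [set w | X_at X J w = fun=> b%:R])
    (G (X_at X I w))%:E)%E = (y b)%:E.
  under eq_integral do rewrite GE.
  by rewrite X_J (integral_outcome_in X (fun S => (i \in S) == b)).
have := NR I J IJ G Gm (fun=> false%:R) (fun=> true%:R) (fun=> ler01).
rewrite /cond_exp !PX !IX !lte_fin => /(_ xf xt).
(* Clearing denominators gives [x false * y true <= x true * y false]; adding [x true * y true] to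
   both sides concludes. *)
rewrite /= -!EFinM lee_fin ler_pdivrMl// mulrCA ler_pdivlMl//.
by have -> : x false = 1 - x true by [lra]; lra.
Qed.

Theorem theorem1 (d : measure_display) (T : measurableType d) (R : realType)
    (P : probability T R) (n : nat) (X : 'I_n -> {RV P >-> R}) (x : 'I_n -> R)
    (X01 : forall i w, X i w = 0 \/ X i w = 1)
    (EX : forall i, 'E_P[X i]%E = (x i)%:E)
    (XN : negatively_associated X \/ negative_regression X)
    (f : {set 'I_n} -> R)
    (f_ge0 : forall S, 0 <= f S)
    (f_mono : monotone_setfun f)
    (f_sub : submodular f)
    (f_marg : forall (S : {set 'I_n}) (i : 'I_n),
       0 <= f (i |: S)%SET - f S <= 1)
    (delta : R) (delta01 : 0 < delta < 1) :
  let mu0 := multilinear_ext f x in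
  (P [set w | (f (outcome X w) <= (1 - delta) * mu0)%R] <=
   (expR (- (mu0 * delta ^+ 2 / 2)))%:E)%E.
Proof.
cbv zeta; set mu0 := multilinear_ext f x; have /andP[/ltW d0 _] := delta01.
have p1 := sum_outcome_law X; have p0 := outcome_law_ge0 X.
have xE i : x i = \sum_S outcome_law X S * (i \in S)%:R.
  apply: EFin_inj; rewrite -EX -expectation_outcome.
  by congr expectation; apply/funext => w; rewrite (RV01E X01).
have x01 i : 0 <= x i <= 1.
  rewrite xE sumr_ge0 => [/=|S _]; last by rewrite mulr_ge0.
  rewrite -[leRHS]p1; apply: ler_sum => S _; by rewrite ler_piMr// lern1 leq_b1.
have mu_ge0 : 0 <= mu0.
  by rewrite -(multilinear_ext_cst x 0); exact: le_multilinear_ext.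
have dom : \sum_S outcome_law X S * expR (- (delta * f S)) <=
    expR (- ((1 - expR (- delta)) * mu0)).
  apply: le_trans (multilinear_ext_expRN_le x01 d0 f_ge0 f_mono f_sub _); last first.
    by move=> S i; case/andP: (f_marg S i).
  have pN i g : monotone_setfun g -> ignores i g ->
      \sum_S outcome_law X S * ((i \in S)%:R * g S) <=
      x i * \sum_S outcome_law X S * g S.
    by rewrite xE; exact: negative_covariance.
  (* Dominance is applied to the negated exponential, so the inequality between the means is
     reversed. *)
  have := submodular_dominance x01 p1 pN (submodular_NexpRN d0 f_mono f_sub).
  rewrite [leLHS](_ : _ = - multilinear_ext (fun S => expR (- (delta * f S))) x).
    by under eq_bigr do rewrite mulrN; rewrite sumrN lerN2.
  by rewrite -sumrN; apply: eq_bigr => S _; rewrite !mulNr.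
rewrite (probability_outcome X (fun S => f S <= (1 - delta) * mu0)) lee_fin.
(* Markov's inequality: the indicator of the event is at most
   [expR (delta * ((1 - delta) * mu0 - f S))]. *)
apply: (@le_trans _ _ (expR (delta * ((1 - delta) * mu0)) *
    \sum_S outcome_law X S * expR (- (delta * f S)))).
  rewrite mulr_sumr; apply: ler_sum => S _; rewrite mulrCA ler_wpM2l//.
  rewrite -expRD; have [fS|_] := boolP (f S <= _); last exact: expR_ge0.
  by rewrite (le_trans _ (expR_ge1Dx _))// lerDl subr_ge0 ler_wpM2l.
apply: (le_trans (ler_wpM2l (expR_ge0 _) dom)).
(* The coefficient of [mu0] is now [delta * (1 - delta) - 1 + expR (- delta)], at most
   [- delta ^+ 2 / 2] by the quadratic bound. *)
rewrite -expRD ler_expR.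
have := ler_wpM2r mu_ge0 (expRN_le_quad d0).
lra.
Qed.
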